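(* Let $A$ and $B$ be semisimple MV-algebras. For any MV-homomorphism $h:A\to B$ there is a unique homomorphism $\mathbf R(h):\mathbf R(A)\to\mathbf R(B)$ such that $\mathbf R(h)\circ\iota_A=\iota_B\circ h$. In addition, if $h$ is an embedding, then $\mathbf R(h)$ is also an embedding.
   Context: An MV-algebra is a structure $(A,\oplus,{}^*,0)$ such that $(A,\oplus,0)$ is an abelian monoid, $(a^* )^*=a$, $0^*\oplus a=0^*$ and $(a^*\oplus b)^*\oplus b=(b^*\oplus a)^*\oplus a$. Put $1=0^*$, $a\odot b=(a^*\oplus b^* )^*$; $a\le b$ iff $a\odot b^*=0$. An ideal is a nonempty downward closed subset closed under $\oplus$; $A$ is semisimple if the intersection of its maximal (proper) ideals is $\{0\}$. Embeddings are injective homomorphisms. A Riesz MV-algebra is an MV-algebra $V$ with a map $\cdot:[0,1]\times V\to V$ such that $r(a\odot b^* )=(ra)\odot(rb)^*$, $\max(r-q,0)\,a=(ra)\odot(qa)^*$, $(rq)a=r(qa)$, $1a=a$ for all $r,q\in[0,1]$, $a,b\in V$. MV-homomorphisms between Riesz MV-algebras automatically preserve scalar multiplication, so homomorphisms of Riesz MV-algebras are just MV-homomorphisms. Riesz hull: for an abelian lattice-ordered group $G$ with strong unit $u$, $\Gamma(G,u)$ is the MV-algebra $[0,u]$ with $x\oplus y=(x+y)\wedge u$, $x^*=u-x$; every MV-algebra is of this form up to isomorphism. If $A=\Gamma(G,u)$, its divisible hull is $A_d=\Gamma(G_d,u)$, where $G_d=\{g/n\mid g\in G,\ n\ge1\}$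 is the divisible hull of $G$. The Dedekind-MacNeille completion $\hat B$ of a semisimple MV-algebra $B$ is the (unique up to isomorphism) MV-algebra containing $B$ as a subalgebra, complete as a lattice, in which every element is a supremum of elements of $B$. For $A$ semisimple, $A_d$ is semisimple and $\widehat{A_d}$ carries a (unique) Riesz MV-algebra structure. $\mathbf R(A)$ is the Riesz MV-subalgebra of $\widehat{A_d}$ generated by the image of $A$ under the composite of canonical embeddings $A\to A_d\to\widehat{A_d}$, and $\iota_A:A\to\mathbf R(A)$ is this composite with codomain restricted to $\mathbf R(A)$. *)

(* Defs.v *)
From HB Require Import structures.
From mathcomp Require Import all_boot all_order all_algebra.
From mathcomp Require Import boolp classical_sets reals interval_inference.

Set Implicit Arguments.
Unset Strict Implicit.
Unset Printing Implicit Defensive.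

Import Order.TTheory GRing.Theory Num.Theory.
Local Open Scope ring_scope.
Local Open Scope classical_set_scope.

Declare Scope mv_scope.
Delimit Scope mv_scope with MV.
Local Open Scope mv_scope.

HB.mixin Record isMVAlgebra (A : Type) := {
  mvzero : A;
  mvneg : A -> A;
  mvadd : A -> A -> A;
  mvaddA : associative mvadd;
  mvaddC : commutative mvadd;
  mvadd0 : right_id mvzero mvadd;
  mvnegK : involutive mvneg;
  mvadd1l : forall a, mvadd (mvneg mvzero) a = mvneg mvzero;
  mvadd_negC : forall a b,
    mvadd (mvneg (mvadd (mvneg a) b)) b = mvadd (mvneg (mvadd (mvneg b) a)) a
}.

#[short(type="mvAlgType")]
HB.structure Definition MVAlgebra := {A of isMVAlgebra A}.

Notation "a ⊕ b" := (mvadd a b) (at level 50, left associativity) : mv_scope.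
Notation "∼ a" := (mvneg a) (at level 35, right associativity) : mv_scope.
Definition mvmul (A : mvAlgType) (a b : A) : A := ∼ (∼ a ⊕ ∼ b).
Notation "a ⊙ b" := (mvmul a b) (at level 40, left associativity) : mv_scope.

Definition mvle (A : mvAlgType) (a b : A) : Prop := a ⊙ ∼ b = mvzero.

Definition mv_hom (A B : mvAlgType) (f : A -> B) : Prop :=
  [/\ f mvzero = mvzero,
      forall a b, f (a ⊕ b) = f a ⊕ f b &
      forall a, f (∼ a) = ∼ f a].

Definition mv_embedding (A B : mvAlgType) (f : A -> B) : Prop :=
  mv_hom f /\ injective f.

Definition mv_iso (A B : mvAlgType) (f : A -> B) : Prop :=
  mv_hom f /\ bijective f.

Definition mv_ideal (A : mvAlgType) (I : set A) : Prop :=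
  [/\ I !=set0,
      forall a b, mvle a b -> I b -> I a &
      forall a b, I a -> I b -> I (a ⊕ b)].

Definition mv_maximal_ideal (A : mvAlgType) (M : set A) : Prop :=
  [/\ mv_ideal M, M <> setT &
      forall I, mv_ideal I -> I <> setT -> M `<=` I -> I = M].

Definition mv_semisimple (A : mvAlgType) : Prop :=
  \bigcap_(M in [set M | mv_maximal_ideal M]) M = [set mvzero : A].

Lemma trunc_sub_ge0 (R : realType) (r q : {i01 R}) :
  0 <= Num.max (r%:num - q%:num) 0.
Proof. by rewrite le_max lexx orbT. Qed.

Lemma trunc_sub_le1 (R : realType) (r q : {i01 R}) :
  Num.max (r%:num - q%:num) 0 <= 1.
Proof.
by rewrite ge_max ler01 andbT lerBlDr (le_trans (le1 r))// lerDl ge0.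
Qed.

Definition trunc_sub (R : realType) (r q : {i01 R}) : {i01 R} :=
  Itv01 (trunc_sub_ge0 r q) (trunc_sub_le1 r q).

HB.mixin Record isRieszMV (R : realType) V of MVAlgebra V := {
  rscale : {i01 R} -> V -> V;
  rscaleBr : forall (r : {i01 R}) (a b : V),
    rscale r (a ⊙ ∼ b) = rscale r a ⊙ ∼ rscale r b;
  rscaleBl : forall (r q : {i01 R}) (a : V),
    rscale (trunc_sub r q) a = rscale r a ⊙ ∼ rscale q a;
  rscaleA : forall (r q : {i01 R}) (a : V),
    rscale (r%:num * q%:num)%:i01 a = rscale r (rscale q a);
  rscale1 : forall a : V, rscale 1%:i01 a = a
}.

#[short(type="rieszMVType")]
HB.structure Definition RieszMV (R : realType) :=
  {V of isRieszMV R V & MVAlgebra V}.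

Definition riesz_closed (R : realType) (V : rieszMVType R) (S : set V) : Prop :=
  [/\ S mvzero,
      forall a b, S a -> S b -> S (a ⊕ b),
      forall a, S a -> S (∼ a) &
      forall (r : {i01 R}) a, S a -> S (rscale r a)].

Definition riesz_span (R : realType) (V : rieszMVType R) (X : set V) : set V :=
  smallest (@riesz_closed R V) X.

Lemma riesz_span_closed (R : realType) (V : rieszMVType R) (X : set V) :
  riesz_closed (riesz_span X).
Proof.
split=> [|a b ha hb|a ha|r a ha] S [] clS XS; have [S0 SD SN SZ] := clS.
- exact: S0.
- by apply: SD; [exact: ha|exact: hb].
- by apply: SN; exact: ha.
- by apply: SZ; exact: ha.
Qed.

Lemma sub_riesz_span (R : realType) (V : rieszMVType R) (X : set V) :
  X `<=` riesz_span X.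
Proof. exact: sub_gen_smallest. Qed.

Definition riesz_gen (R : realType) (V : rieszMVType R) (X : set V) : Type :=
  {x : V | x \in riesz_span X}.

Section RieszGen.
Variables (R : realType) (V : rieszMVType R) (X : set V).
Local Notation T := (riesz_gen X).

Fact gen_zero_subproof : (mvzero : V) \in riesz_span X.
Proof. by apply/mem_set; have [] := riesz_span_closed X. Qed.

Fact gen_neg_subproof (x : T) : ∼ sval x \in riesz_span X.
Proof.
by apply/mem_set; have [_ _ + _] := riesz_span_closed X; apply;
   exact/set_mem/(svalP x).
Qed.

Fact gen_add_subproof (x y : T) : sval x ⊕ sval y \in riesz_span X.
Proof.
by apply/mem_set; have [_ + _ _] := riesz_span_closed X; apply;
   [exact/set_mem/(svalP x)|exact/set_mem/(svalP y)].
Qed.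

Fact gen_scale_subproof (r : {i01 R}) (x : T) :
  rscale r (sval x) \in riesz_span X.
Proof.
by apply/mem_set; have [_ _ _ +] := riesz_span_closed X; apply;
   exact/set_mem/(svalP x).
Qed.

Definition gen_zero : T := exist _ mvzero gen_zero_subproof.
Definition gen_neg (x : T) : T := exist _ (∼ sval x) (gen_neg_subproof x).
Definition gen_add (x y : T) : T :=
  exist _ (sval x ⊕ sval y) (gen_add_subproof x y).
Definition gen_scale (r : {i01 R}) (x : T) : T :=
  exist _ (rscale r (sval x)) (gen_scale_subproof r x).

Fact gen_inj (x y : T) : sval x = sval y -> x = y.
Proof. exact: val_inj. Qed.

Fact gen_addA : associative gen_add.
Proof. by move=> x y z; apply: gen_inj; rewrite /= mvaddA. Qed.
Fact gen_addC : commutative gen_add.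
Proof. by move=> x y; apply: gen_inj; rewrite /= mvaddC. Qed.
Fact gen_add0 : right_id gen_zero gen_add.
Proof. by move=> x; apply: gen_inj; rewrite /= mvadd0. Qed.
Fact gen_negK : involutive gen_neg.
Proof. by move=> x; apply: gen_inj; rewrite /= mvnegK. Qed.
Fact gen_add1l a : gen_add (gen_neg gen_zero) a = gen_neg gen_zero.
Proof. by apply: gen_inj; rewrite /= mvadd1l. Qed.
Fact gen_add_negC a b : gen_add (gen_neg (gen_add (gen_neg a) b)) b =
  gen_add (gen_neg (gen_add (gen_neg b) a)) a.
Proof. by apply: gen_inj; rewrite /= mvadd_negC. Qed.

HB.instance Definition _ := isMVAlgebra.Build T
  gen_addA gen_addC gen_add0 gen_negK gen_add1l gen_add_negC.

Fact gen_scaleBr r (a b : T) :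
  gen_scale r (a ⊙ ∼ b) = gen_scale r a ⊙ ∼ gen_scale r b.
Proof. by apply: gen_inj; exact: rscaleBr. Qed.
Fact gen_scaleBl r q (a : T) :
  gen_scale (trunc_sub r q) a = gen_scale r a ⊙ ∼ gen_scale q a.
Proof. by apply: gen_inj; exact: rscaleBl. Qed.
Fact gen_scaleA (r q : {i01 R}) (a : T) :
  gen_scale (r%:num * q%:num)%:i01 a = gen_scale r (gen_scale q a).
Proof. by apply: gen_inj; exact: rscaleA. Qed.
Fact gen_scale1 (a : T) : gen_scale 1%:i01 a = a.
Proof. by apply: gen_inj; exact: rscale1. Qed.

HB.instance Definition _ := isRieszMV.Build R T
  gen_scaleBr gen_scaleBl gen_scaleA gen_scale1.

End RieszGen.

(* The meet and the join are fields here because Hierarchy Builder does not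
   accept a join of [Order.Lattice] and [GRing.Zmodule] declared after
   [Num.RealDomain]. *)
HB.mixin Record isUnitalLGroup G of Num.POrderedZmodule G := {
  lg_leD2r : forall x y z : G, x <= y -> x + z <= y + z;
  lg_meet : G -> G -> G;
  lg_join : G -> G -> G;
  lg_lexI : forall x y z : G, (z <= lg_meet x y) = (z <= x) && (z <= y);
  lg_leUx : forall x y z : G, (lg_join x y <= z) = (x <= z) && (y <= z);
  lg_unit : G;
  lg_unit_ge0 : 0 <= lg_unit;
  lg_unit_strong : forall x : G, exists n : nat, x <= lg_unit *+ n
}.

#[short(type="ulGroupType")]
HB.structure Definition UnitalLGroup :=
  {G of isUnitalLGroup G & Num.POrderedZmodule G}.

Section LGroupTheory.
Variable G : ulGroupType.
Implicit Types x y z : G.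

Lemma lg_leIl x y : lg_meet x y <= x.
Proof. by have := lexx (lg_meet x y); rewrite lg_lexI => /andP[]. Qed.

Lemma lg_leIr x y : lg_meet x y <= y.
Proof. by have := lexx (lg_meet x y); rewrite lg_lexI => /andP[]. Qed.

Lemma lg_leUl x y : x <= lg_join x y.
Proof. by have := lexx (lg_join x y); rewrite lg_leUx => /andP[]. Qed.

Lemma lg_leUr x y : y <= lg_join x y.
Proof. by have := lexx (lg_join x y); rewrite lg_leUx => /andP[]. Qed.

Lemma lg_meet_idPl x y : reflect (lg_meet x y = x) (x <= y).
Proof.
apply: (iffP idP) => [xy|<-]; last exact: lg_leIr.
by apply/eqP; rewrite eq_le lg_leIl lg_lexI lexx xy.
Qed.

Lemma lg_meetC x y : lg_meet x y = lg_meet y x.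
Proof. by apply/eqP; rewrite eq_le !lg_lexI !lg_leIl !lg_leIr. Qed.

Lemma lg_joinC x y : lg_join x y = lg_join y x.
Proof. by apply/eqP; rewrite eq_le !lg_leUx !lg_leUl !lg_leUr. Qed.

Lemma lg_meet_idPr x y : reflect (lg_meet y x = x) (x <= y).
Proof. by rewrite lg_meetC; exact: lg_meet_idPl. Qed.

Lemma lg_meetA x y z : lg_meet x (lg_meet y z) = lg_meet (lg_meet x y) z.
Proof.
suff H t : (t <= lg_meet x (lg_meet y z)) = (t <= lg_meet (lg_meet x y) z).
  by apply/eqP; rewrite eq_le -H lexx H lexx.
by rewrite !lg_lexI andbA.
Qed.

Lemma lg_leD2rE x y z : (x + z <= y + z) = (x <= y).
Proof.
apply/idP/idP => [h|]; last exact: lg_leD2r.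
by have := lg_leD2r _ _ (- z) h; rewrite !addrK.
Qed.

Lemma lg_subr_ge0 x y : (0 <= y - x) = (x <= y).
Proof. by rewrite -(lg_leD2rE 0 _ x) add0r subrK. Qed.

Lemma lg_leN2 x y : (- x <= - y) = (y <= x).
Proof. by rewrite -[RHS]lg_subr_ge0 -[LHS]lg_subr_ge0 opprK addrC. Qed.

Lemma lg_leDl x y : 0 <= y -> x <= x + y.
Proof. by move=> y0; rewrite -lg_subr_ge0 addrC addKr. Qed.

Lemma lg_meetDr x y z :
  lg_meet x y + z = lg_meet (x + z) (y + z).
Proof.
apply/eqP; rewrite eq_le lg_lexI !lg_leD2rE lg_leIl lg_leIr /=.
by rewrite -(lg_leD2rE _ _ (- z)) addrK lg_lexI -!(lg_leD2rE (_ - z) _ z) !subrK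
           lg_leIl lg_leIr.
Qed.

Lemma lg_oppI x y : - lg_meet x y = lg_join (- x) (- y).
Proof.
apply/eqP; rewrite eq_le lg_leUx !lg_leN2 lg_leIl lg_leIr andbT.
by rewrite -lg_leN2 opprK lg_lexI -!(lg_leN2 _ (- lg_join _ _)) !opprK lg_leUl
           lg_leUr.
Qed.

Lemma lg_joinDr x y z :
  lg_join x y + z = lg_join (x + z) (y + z).
Proof.
apply/eqP; rewrite eq_le [X in _ && X]lg_leUx !lg_leD2rE lg_leUl lg_leUr !andbT.
by rewrite -(lg_leD2rE _ _ (- z)) addrK lg_leUx -!(lg_leD2rE _ (_ - z) z) !subrK
           lg_leUl lg_leUr.
Qed.

End LGroupTheory.

Definition ul_hom (G H : ulGroupType) (f : G -> H) : Prop :=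
  [/\ {morph f : x y / x + y},
      {morph f : x y / lg_meet x y},
      {morph f : x y / lg_join x y} &
      f lg_unit = lg_unit].

Lemma ul_hom0 (G H : ulGroupType) (f : G -> H) : ul_hom f -> f 0 = 0.
Proof. by case=> fD _ _ _; apply: (addrI (f 0)); rewrite -fD !addr0. Qed.

Lemma ul_hom_le (G H : ulGroupType) (f : G -> H) :
  ul_hom f -> {homo f : x y / x <= y}.
Proof. by case=> _ fI _ _ x y /lg_meet_idPl xy; rewrite -xy fI lg_leIr. Qed.

Definition Gamma (G : ulGroupType) : Type :=
  {x : G | (0 <= x) && (x <= lg_unit)}.

Section Gamma.
Variable G : ulGroupType.
Local Notation u := (lg_unit : G).
Local Notation T := (Gamma G).

Fact Gamma_zero_subproof : (0 <= (0 : G)) && (0 <= u).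
Proof. by rewrite lexx lg_unit_ge0. Qed.

Fact Gamma_neg_subproof (x : T) : (0 <= u - sval x) && (u - sval x <= u).
Proof.
case: x => x /= /andP[x0 xu]; rewrite lg_subr_ge0 xu /=.
by rewrite -lg_subr_ge0 opprB addrC subrK.
Qed.

Fact Gamma_add_subproof (x y : T) :
  (0 <= lg_meet (sval x + sval y) u) &&
  (lg_meet (sval x + sval y) u <= u).
Proof.
case: x y => x /= /andP[x0 xu] [y /= /andP[y0 yu]].
rewrite lg_leIr andbT lg_lexI lg_unit_ge0 andbT (le_trans y0)//.
by rewrite -{1}[y]add0r lg_leD2rE.
Qed.

Definition Gamma_zero : T := exist _ 0 Gamma_zero_subproof.
Definition Gamma_neg (x : T) : T := exist _ (u - sval x) (Gamma_neg_subproof x).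
Definition Gamma_add (x y : T) : T :=
  exist _ (lg_meet (sval x + sval y) u) (Gamma_add_subproof x y).

Fact Gamma_inj (x y : T) : sval x = sval y -> x = y.
Proof. exact: val_inj. Qed.

Fact Gamma_addC : commutative Gamma_add.
Proof. by move=> x y; apply: Gamma_inj; rewrite /= addrC. Qed.

Fact Gamma_addA : associative Gamma_add.
Proof.
have E (x y z : T) : lg_meet (lg_meet (sval x + sval y) u + sval z) u
    = lg_meet (sval x + sval y + sval z) u.
  rewrite lg_meetDr -lg_meetA; congr lg_meet; apply/lg_meet_idPr.
  by have /andP[z0 _] := svalP z; exact: lg_leDl.
move=> x y z; apply: Gamma_inj => /=.
by rewrite E [sval x + _]addrC E; congr lg_meet; rewrite addrC addrA.
Qed.

Fact Gamma_add0 : right_id Gamma_zero Gamma_add.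
Proof.
move=> x; apply: Gamma_inj; rewrite /= addr0; apply/lg_meet_idPl.
by have /andP[] := svalP x.
Qed.

Fact Gamma_negK : involutive Gamma_neg.
Proof. by move=> x; apply: Gamma_inj; rewrite /= opprB addrC subrK. Qed.

Fact Gamma_add1l a :
  Gamma_add (Gamma_neg Gamma_zero) a = Gamma_neg Gamma_zero.
Proof.
apply: Gamma_inj; rewrite /= subr0; apply/lg_meet_idPr.
by have /andP[a0 _] := svalP a; exact: lg_leDl.
Qed.

Fact Gamma_add_negE (a b : T) :
  sval (Gamma_add (Gamma_neg (Gamma_add (Gamma_neg a) b)) b) =
  lg_join (sval a) (sval b).
Proof.
case: a b => a /= /andP[_ au] [b /= /andP[_ bu]].
rewrite addrC addrA [b + u]addrC lg_oppI addrC lg_joinDr !opprD !opprK.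
have -> : - u + a - b + (u + b) = a.
  by rewrite [u + b]addrC addrA subrK addrC addrA subrr add0r.
have -> : - u + (u + b) = b by rewrite addrA addNr add0r.
by apply/lg_meet_idPl; rewrite lg_leUx au bu.
Qed.

Fact Gamma_add_negC a b : Gamma_add (Gamma_neg (Gamma_add (Gamma_neg a) b)) b =
  Gamma_add (Gamma_neg (Gamma_add (Gamma_neg b) a)) a.
Proof. by apply: Gamma_inj; rewrite !Gamma_add_negE lg_joinC. Qed.

HB.instance Definition _ := isMVAlgebra.Build T
  Gamma_addA Gamma_addC Gamma_add0 Gamma_negK Gamma_add1l Gamma_add_negC.

End Gamma.

Fact Gamma_map_subproof (G H : ulGroupType) (f : G -> H) (hf : ul_hom f)
    (x : Gamma G) : (0 <= f (sval x)) && (f (sval x) <= lg_unit).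
Proof.
case: x => x /= /andP[x0 xu]; rewrite -(ul_hom0 hf) (ul_hom_le hf x0) /=.
by have [_ _ _ <-] := hf; exact: ul_hom_le.
Qed.

Definition Gamma_map (G H : ulGroupType) (f : G -> H) (hf : ul_hom f)
    (x : Gamma G) : Gamma H :=
  exist _ (f (sval x)) (Gamma_map_subproof hf x).

(* [i] exhibits [Gd] as the group of the quotients [g / n]. The quotient [g / n]
   is the [x] with [x *+ n = i g]; it is unique, lattice-ordered groups being
   torsion-free. *)
Definition is_divisible_hull (G Gd : ulGroupType) (i : G -> Gd) : Prop :=
  [/\ ul_hom i, injective i,
      forall g (n : nat), (0 < n)%N -> exists x, x *+ n = i g &
      forall x, exists g, exists2 n : nat, (0 < n)%N & x *+ n = i g].

Definition mv_is_sup (A : mvAlgType) (S : set A) (s : A) : Prop :=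
  (forall a, S a -> mvle a s) /\
  (forall t, (forall a, S a -> mvle a t) -> mvle s t).

Definition mv_is_inf (A : mvAlgType) (S : set A) (s : A) : Prop :=
  (forall a, S a -> mvle s a) /\
  (forall t, (forall a, S a -> mvle t a) -> mvle t s).

Definition mv_complete (A : mvAlgType) : Prop :=
  forall S : set A, (exists s, mv_is_sup S s) /\ (exists s, mv_is_inf S s).

Definition is_DM_completion (B C : mvAlgType) (j : B -> C) : Prop :=
  [/\ mv_embedding j, mv_complete C &
      forall c, exists S : set B, mv_is_sup (j @` S) c].

(* The objects entering the construction of the Riesz hull of [A] are only
   determined up to isomorphism; a value of this type is a choice of them. *)
Record riesz_hull_data (R : realType) (A : mvAlgType) := RieszHullData {
  rh_group : ulGroupType;
  rh_iso : A -> Gamma rh_group;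
  rh_isoP : mv_iso rh_iso;
  rh_div : ulGroupType;
  rh_to_div : rh_group -> rh_div;
  rh_divP : is_divisible_hull rh_to_div;
  rh_compl : rieszMVType R;
  rh_to_compl : Gamma rh_div -> rh_compl;
  rh_complP : is_DM_completion rh_to_compl
}.

Arguments rh_iso {R A} r _.
Arguments rh_isoP {R A} r.
Arguments rh_to_div {R A} r _.
Arguments rh_divP {R A} r.
Arguments rh_to_compl {R A} r _.
Arguments rh_complP {R A} r.

Section RieszHull.
Variables (R : realType) (A : mvAlgType) (D : riesz_hull_data R A).

Fact rh_div_hom : ul_hom (rh_to_div D).
Proof. by have [] := rh_divP D. Qed.

Definition to_compl (a : A) : rh_compl D :=
  rh_to_compl D (Gamma_map rh_div_hom (rh_iso D a)).

Definition riesz_hull : rieszMVType R := riesz_gen (range to_compl).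

Fact riesz_iota_subproof a : to_compl a \in riesz_span (range to_compl).
Proof. by apply: mem_set; apply: sub_riesz_span; exists a. Qed.

Definition riesz_iota (a : A) : riesz_hull :=
  exist _ (to_compl a) (riesz_iota_subproof a).

End RieszHull.

Arguments riesz_hull {R A} D.
Arguments riesz_iota {R A} D a.

(* Main.v *)
Require Import Defs.
From mathcomp Require Import all_boot all_order all_algebra.
From mathcomp Require Import boolp classical_sets reals interval_inference.
From mathcomp Require Import lra.

(* A character of an MV-algebra is a homomorphism to [0,1]. Characters are
   homogeneous on Riesz MV-algebras, they separate the points of a complete one,
   and a character of A extends along every embedding of A into a Riesz
   MV-algebra: the ideal generated by its kernel is contained in a prime ideal,
   whose standard part is a character, and a character is determined by its
   kernel. Hence R(h) x is the only y with f x = g y for all characters f of R(A)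
   and g of R(B) such that f iota_A = g iota_B h; the x that have such a y form a
   Riesz subalgebra containing iota_A(A). *)

Set Implicit Arguments.
Unset Strict Implicit.
Unset Printing Implicit Defensive.

Import Order.TTheory GRing.Theory Num.Theory.
Local Open Scope ring_scope.
Local Open Scope classical_set_scope.
Local Open Scope mv_scope.

Local Notation "a ⊖ b" := (a ⊙ ∼ b) (at level 40, left associativity) : mv_scope.

(** * Arithmetic of MV-algebras *)

Section MVArithmetic.
Variable A : mvAlgType.
Implicit Types a b c d t : A.

Lemma mvadd0l a : mvzero ⊕ a = a.
Proof. by rewrite mvaddC mvadd0. Qed.

Lemma mvaddN a : a ⊕ ∼ a = ∼ mvzero.
Proof.
have := mvadd_negC a (∼ mvzero).
by rewrite mvnegK mvadd0l !(mvaddC _ (∼ mvzero)) !mvadd1l (mvaddC a).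
Qed.

Lemma mvsubxx a : a ⊖ a = mvzero.
Proof. by rewrite /mvmul mvaddN mvnegK. Qed.

Lemma mvsub0l a : mvzero ⊖ a = mvzero.
Proof. by rewrite /mvmul mvadd1l mvnegK. Qed.

Lemma mvsub0 a : a ⊖ mvzero = a.
Proof. by rewrite /mvmul mvnegK mvadd0 mvnegK. Qed.

Lemma mvsub1l a : ∼ mvzero ⊖ a = ∼ a.
Proof. by rewrite /mvmul !mvnegK mvadd0l. Qed.

Lemma mvsubN a b : ∼ a ⊖ ∼ b = b ⊖ a.
Proof. by rewrite /mvmul !mvnegK mvaddC. Qed.

Lemma mvsubDr a b c : a ⊖ (b ⊕ c) = a ⊖ b ⊖ c.
Proof. by rewrite /mvmul !mvnegK mvaddA. Qed.

Lemma mvaddsubC a b : a ⊕ (b ⊖ a) = b ⊕ (a ⊖ b).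
Proof. by rewrite ![_ ⊕ (_ ⊖ _)]mvaddC /mvmul !mvnegK mvadd_negC. Qed.

Lemma mvaddE a b : a ⊕ b = ∼ (∼ a ⊖ b).
Proof. by rewrite /mvmul !mvnegK. Qed.

Lemma mvsubLR a b c : mvle (a ⊖ b) c <-> mvle a (b ⊕ c).
Proof. by rewrite /mvle mvsubDr. Qed.

Lemma mvlexx a : mvle a a.
Proof. exact: mvsubxx. Qed.

Lemma mvle_addr a b : mvle a (a ⊕ b).
Proof. by rewrite /mvle mvsubDr mvsubxx mvsub0l. Qed.

Lemma mvle_addl a b : mvle a (b ⊕ a).
Proof. by rewrite mvaddC; exact: mvle_addr. Qed.

Lemma mvaddsub a b : mvle a b -> a ⊕ (b ⊖ a) = b.
Proof. by move=> ab; rewrite mvaddsubC [a ⊖ b]ab mvadd0. Qed.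

Lemma mvle_anti a b : mvle a b -> mvle b a -> a = b.
Proof. by move=> ab ba; rewrite -(mvaddsub ab) [b ⊖ a]ba mvadd0. Qed.

Lemma mvle_trans b a c : mvle a b -> mvle b c -> mvle a c.
Proof.
by move=> /mvaddsub <- /mvaddsub <-; rewrite -mvaddA; exact: mvle_addr.
Qed.

Lemma mvle0 a : mvle a mvzero -> a = mvzero.
Proof. by rewrite /mvle mvsub0. Qed.

Lemma mvle_sub a b : mvle (a ⊖ b) a.
Proof. by apply/mvsubLR; exact: mvle_addl. Qed.

Lemma mvle1 a : mvle a (∼ mvzero).
Proof. by rewrite /mvle /mvmul mvnegK mvaddC mvadd1l mvnegK. Qed.

Lemma mvsub_leN a b : mvle (a ⊖ b) (∼ b).
Proof. by apply/mvsubLR; rewrite mvaddN; exact: mvle1. Qed.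

Lemma mvle_addsub a b : mvle a (b ⊕ (a ⊖ b)).
Proof. by apply/mvsubLR; exact: mvlexx. Qed.

Lemma mvleD a b c d : mvle a b -> mvle c d -> mvle (a ⊕ c) (b ⊕ d).
Proof.
have le2r (x y z : A) : mvle x y -> mvle (x ⊕ z) (y ⊕ z).
  by move=> xy; rewrite -(mvaddsub xy) -mvaddA (mvaddC (y ⊖ x)) mvaddA;
     exact: mvle_addr.
move=> ab cd; apply: mvle_trans (le2r _ _ _ ab) _.
by rewrite !(mvaddC b); exact: le2r.
Qed.

Lemma mvleN a b : mvle a b -> mvle (∼ b) (∼ a).
Proof. by rewrite /mvle mvsubN. Qed.

Lemma mvle_sub2r a b c : mvle a b -> mvle (a ⊖ c) (b ⊖ c).
Proof.
by move=> ab; apply/mvsubLR; apply: mvle_trans ab _; exact: mvle_addsub.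
Qed.

Lemma mvsub_trans a b c : mvle (a ⊖ c) ((a ⊖ b) ⊕ (b ⊖ c)).
Proof.
apply/mvsubLR; rewrite (mvaddC (a ⊖ b)) mvaddA.
apply: mvle_trans (mvle_addsub a b) _.
by apply: mvleD (mvlexx _); exact: mvle_addsub.
Qed.

Lemma mvsubDD a b c d : mvle ((a ⊕ b) ⊖ (c ⊕ d)) ((a ⊖ c) ⊕ (b ⊖ d)).
Proof.
apply/mvsubLR; rewrite mvaddA -(mvaddA c) (mvaddC d) mvaddA -mvaddA.
by apply: mvleD; exact: mvle_addsub.
Qed.

Lemma mvle_sub2l a b c : mvle a b -> mvle (c ⊖ b) (c ⊖ a).
Proof. by move=> /mvleN/(@mvle_sub2r _ _ (∼ c)); rewrite !mvsubN. Qed.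

(** Both sides are the meet of [a] and [b]; the symmetry is [mvadd_negC] at the negated elements. *)
Lemma mvsub_meetC a b : a ⊖ (a ⊖ b) = b ⊖ (b ⊖ a).
Proof.
have := mvadd_negC (∼ b) (∼ a); rewrite /mvmul !mvnegK => E.
by rewrite (mvaddC (∼ a) b) (mvaddC (∼ b) a) !(mvaddC (∼ _) (∼ (_ ⊕ _))) E.
Qed.

Lemma mvle_meet a b c : mvle a b -> mvle a c -> mvle a (b ⊖ (b ⊖ c)).
Proof.
move=> ab ac; have := mvle_sub2l b (mvle_sub2l b ac).
by rewrite mvsub_meetC [a ⊖ b]ab mvsub0.
Qed.

Lemma mvsub_meetr a b : mvle (a ⊖ (a ⊖ b)) b.
Proof. by rewrite mvsub_meetC; exact: mvle_sub. Qed.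

(** The hypothesis makes [a] its own meet with [∼ b]; computed from the side of [∼ b], that meet is
    the left-hand side. *)
Lemma mvaddK a b : mvle a (∼ b) -> (a ⊕ b) ⊖ b = a.
Proof.
move=> ab; rewrite -[RHS]mvsub0 -[in RHS]ab mvsub_meetC.
by rewrite /mvmul !mvnegK (mvaddC b a) (mvaddC b).
Qed.

Definition mvdisj a b := forall t, mvle t a -> mvle t b -> t = mvzero.

Lemma mvdisjC a b : mvdisj a b -> mvdisj b a.
Proof. by move=> ab t tb ta; exact: ab. Qed.

(** With [d] the meet of [a] and [b], the two differences are [a ⊖ d] and [b ⊖ d]. Adding a common
    lower bound [t] to [d] stays below [a] and [b], hence below [d]; the sum is not truncated, so
    [t] is zero. *)
Lemma mvdisj_sub a b : mvdisj (a ⊖ b) (b ⊖ a).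
Proof.
move=> t tab tba; set d := a ⊖ (a ⊖ b).
have da : a ⊖ b = a ⊖ d.
  by rewrite /d mvsub_meetC [(a ⊖ b) ⊖ a](mvle_sub a b) mvsub0.
have db : b ⊖ a = b ⊖ d.
  by rewrite /d mvsub_meetC mvsub_meetC [(b ⊖ a) ⊖ b](mvle_sub b a) mvsub0.
have tda : mvle (t ⊕ d) a.
  rewrite -[X in mvle _ X](mvaddsub (mvle_sub a (a ⊖ b))) mvaddC.
  by apply: mvleD (mvlexx _) _; rewrite -/d -da.
have tdb : mvle (t ⊕ d) b.
  rewrite -[X in mvle _ X](mvaddsub (mvsub_meetr a b)) mvaddC.
  by apply: mvleD (mvlexx _) _; rewrite -/d -db.
have tdd : mvle (t ⊕ d) d by exact: mvle_meet.
have td : mvle t (∼ d) by apply: mvle_trans tab _; rewrite da; exact: mvsub_leN.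
have -> : t = (t ⊕ d) ⊖ d by rewrite mvaddK.
exact: tdd.
Qed.

(** If [t] is below [a] and [b ⊕ c], its meet with [b] is zero, so [t] is below [t ⊖ b], which is
    below [c]. *)
Lemma mvdisjD a b c : mvdisj a b -> mvdisj a c -> mvdisj a (b ⊕ c).
Proof.
move=> ab ac t ta tbc.
have tb0 : t ⊖ (t ⊖ b) = mvzero.
  by apply: ab (mvsub_meetr t b); apply: mvle_trans (mvle_sub _ _) ta.
apply: ac ta _; have /mvle_trans : mvle t (t ⊖ b) by exact: tb0.
by apply; exact/mvsubLR.
Qed.

(** [iterop] makes [mvmuln 1 a] reduce to [a]. *)
Definition mvmuln n a := iterop n (@mvadd A) a mvzero.

Lemma mvmulnS n a : mvmuln n.+1 a = a ⊕ mvmuln n a.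
Proof. by case: n => //=; rewrite mvadd0. Qed.

Lemma mvdisj_muln n a b : mvdisj a b -> mvdisj a (mvmuln n b).
Proof.
move=> ab; elim: n => [|n IH]; first by move=> t _ /mvle0.
by rewrite mvmulnS; exact: mvdisjD.
Qed.

End MVArithmetic.

(** * Characters with values in the unit interval *)

(** Iterated doubling bounds [2 ^+ n] times [|g t|] by 1 for every [n], and [R] is archimedean. This
    serves for the difference of two characters and for the defect of homogeneity of one. *)
Lemma doubling_eq0 (R : realType) (T : Type) (g : T -> R) :
    (forall t, `|g t| <= 1) -> (forall t, exists s, 2 * `|g t| <= `|g s|) ->
  forall t, g t = 0.
Proof.
move=> g1 gd t; apply/eqP; rewrite -normr_le0 leNgt; apply/negP => gt0.
have H n s : `|g s| *+ n <= 1.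
  suff : `|g s| * 2 ^+ n <= 1.
    apply: le_trans; rewrite -[_ *+ n]mulr_natr ler_wpM2l// -natrX ler_nat.
    exact/ltnW/ltn_expl.
  elim: n s => [|n IH] s; first by rewrite mulr1.
  have [s' ss'] := gd s; apply: le_trans (IH s').
  by rewrite exprS mulrA (mulrC _ 2) ler_wpM2r// exprn_ge0.
have := H (Num.bound `|g t|^-1) t; rewrite -mulr_natl leNgt => /negP; apply.
rewrite -[X in X < _](mulVf (lt0r_neq0 gt0)) ltr_pM2r//.
by rewrite archi_boundP// invr_ge0 ltW.
Qed.

Lemma normr_dbl (R : realType) (x y : R) : 2 * x = y -> 2 * `|x| <= `|y|.
Proof. by move=> <-; rewrite normrM ger0_norm. Qed.

(** Truncation is written out in [R], so that values are compared by linear arithmetic; the upper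
    bound 1 comes from negation. *)
Definition mv_char (R : realType) (A : mvAlgType) (f : A -> R) : Prop :=
  [/\ f mvzero = 0, forall a b, f (a ⊕ b) = Num.min (f a + f b) 1,
      forall a, f (∼ a) = 1 - f a & forall a, 0 <= f a].

Section Characters.
Variables (R : realType) (A : mvAlgType) (f : A -> R).
Hypothesis fP : mv_char f.

Lemma mv_char_le1 a : f a <= 1.
Proof. by have [_ _ fN f0] := fP; have := f0 (∼ a); rewrite fN subr_ge0. Qed.

Lemma mv_char_sub a b : f (a ⊖ b) = Num.max (f a - f b) 0.
Proof.
have [_ fD fN _] := fP; rewrite /mvmul fN fD !fN.
by case: leP => ?; case: leP => ?; lra.
Qed.

Lemma mv_char_comp (B : mvAlgType) (g : B -> A) : mv_hom g -> mv_char (f \o g).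
Proof.
have [f0 fD fN fge0] := fP; case=> g0 gD gN.
by split=> [|a b|a|a] /=; rewrite ?g0 ?gD ?gN.
Qed.

End Characters.

(* If f and g disagree at a, then doubling a (as a ⊕ a or as a ⊙ a) doubles
   the difference of the values as long as both lie on the same side of 1/2;
   they cannot lie on opposite sides, because ker f is contained in ker g. *)
Lemma mv_char_eq (R : realType) (A : mvAlgType) (f g : A -> R) :
  mv_char f -> mv_char g -> (forall a, f a = 0 -> g a = 0) -> f =1 g.
Proof.
move=> fP gP fg a; apply/eqP; rewrite -subr_eq0; apply/eqP; move: a.
have [f0 fD fN fge0] := fP; have [g0 gD gN gge0] := gP.
have fg1 a : f a = 1 -> g a = 1.
  by move=> fa; have := fg (∼ a); rewrite fN gN fa => /(_ (subrr _)); lra.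
apply: doubling_eq0 => a; have := fge0 a; have := gge0 a;
  have := mv_char_le1 fP a; have := mv_char_le1 gP a.
  by rewrite ler_norml; lra.
move=> ga1 fa1 ga0 fa0.
have [fa|fa] := leP (f a) (1 / 2).
  (* [a ⊖ ∼ a] is [a ⊙ a]; a character vanishes there exactly when its value at [a] is at most
     1/2. *)
  have fs : f (a ⊖ ∼ a) = 0 by rewrite (mv_char_sub fP) fN; case: leP; lra.
  have ga : g a <= 1 / 2.
    have := fg _ fs; rewrite (mv_char_sub gP) gN => /max_idPr; lra.
  exists (a ⊕ a); rewrite fD gD.
  have -> : Num.min (f a + f a) 1 = f a + f a by case: leP; lra.
  have -> : Num.min (g a + g a) 1 = g a + g a by case: leP; lra.
  by apply: normr_dbl; lra.
have fs : f (a ⊕ a) = 1 by rewrite fD; case: leP; lra.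
have ga : 1 / 2 <= g a by have := fg1 _ fs; rewrite gD => /min_idPr; lra.
exists (a ⊖ ∼ a); rewrite (mv_char_sub fP) (mv_char_sub gP) fN gN.
have -> : Num.max (f a - (1 - f a)) 0 = f a - (1 - f a) by case: leP; lra.
have -> : Num.max (g a - (1 - g a)) 0 = g a - (1 - g a) by case: leP; lra.
by apply: normr_dbl; lra.
Qed.

Lemma mv_char_scale (R : realType) (V : rieszMVType R) (f : V -> R) :
  mv_char f -> forall (r : {i01 R}) x, f (rscale r x) = r%:num * f x.
Proof.
move=> fP r x; apply/eqP; rewrite -subr_eq0; apply/eqP; move: r.
have [f0 fD fN fge0] := fP; have fle1 := mv_char_le1 fP.
have fB (r q : {i01 R}) : f (rscale (trunc_sub r q) x) =
    Num.max (f (rscale r x) - f (rscale q x)) 0.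
  by rewrite rscaleBl (mv_char_sub fP).
(* r |-> f (r x) is additive on the unit interval, so that its difference with
   r f(x) doubles from r to 2 r, and changes sign from r to 1 - r. *)
have f_le (q r : {i01 R}) : q%:num <= r%:num -> f (rscale q x) <= f (rscale r x).
  move=> qr; have := fB q r.
  (* Both truncated differences are the scalar 0, since [q] is at most [r]. *)
  have -> : trunc_sub q r = trunc_sub q q.
    by apply: val_inj => /=; rewrite subrr maxxx; case: leP; lra.
  rewrite fB subrr maxxx => /esym/max_idPr; lra.
have f_sub (s q r : {i01 R}) : s%:num = r%:num - q%:num ->
    f (rscale s x) = f (rscale r x) - f (rscale q x).
  move=> srq; have s0 : 0 <= s%:num by [].
  have -> : s = trunc_sub r q.
    by apply: val_inj => /=; case: leP; lra.
  by rewrite fB; apply/max_idPl; rewrite subr_ge0; apply: f_le; lra.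
have f_dbl (q : {i01 R}) : q%:num <= 1 / 2 -> exists s : {i01 R},
    2 * (f (rscale q x) - q%:num * f x) = f (rscale s x) - s%:num * f x.
  move=> q2; have q0 : 0 <= q%:num by [].
  have s0 : 0 <= 2 * q%:num by lra.
  have s1 : 2 * q%:num <= 1 by lra.
  pose s := Itv01 s0 s1; have sE : s%:num = 2 * q%:num by [].
  have fq : f (rscale q x) = f (rscale s x) - f (rscale q x).
    by apply: f_sub; rewrite sE; lra.
  by exists s; rewrite sE; lra.
apply: doubling_eq0 => r; have r0 : 0 <= r%:num by [].
  have r1 : r%:num <= 1 by [].
  have := fge0 (rscale r x); have := fle1 (rscale r x); rewrite ler_norml.
  by have := fge0 x; have := fle1 x; nra.
have [/f_dbl[s /normr_dbl]|r2] := leP (r%:num) (1 / 2); first by exists s.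
have r1 : r%:num <= 1 by [].
have q0 : 0 <= 1 - r%:num by lra.
have q1 : 1 - r%:num <= 1 by lra.
have [|s sE] := f_dbl (Itv01 q0 q1); first by rewrite /=; lra.
exists s; rewrite -normrN; apply: normr_dbl; rewrite -sE.
have -> : f (rscale (Itv01 q0 q1) x) = f x - f (rscale r x).
  by rewrite -[X in _ = f X - _](@rscale1 R V); apply: f_sub.
rewrite /=; lra.
Qed.

(** * Ideals and the characters vanishing on them *)

Lemma mvmulnD (A : mvAlgType) n k (a : A) :
  mvmuln (n + k) a = mvmuln n a ⊕ mvmuln k a.
Proof.
elim: n => [|n IH]; first by rewrite mvadd0l.
by rewrite addSn !mvmulnS IH mvaddA.
Qed.

Section Ideals.
Variable A : mvAlgType.
Implicit Types (I M : set A) (a b u : A).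

Lemma mv_ideal0 I : mv_ideal I -> I mvzero.
Proof. by case=> -[a Ia] Id _; apply: Id Ia; rewrite /mvle mvsub0l. Qed.

Lemma mv_ideal_set0 : mv_ideal [set mvzero : A].
Proof.
split=> [|a b ab /= b0|a b /= -> ->]; first by exists mvzero.
  by apply: mvle0; rewrite -b0.
by rewrite mvadd0.
Qed.

(** For an ideal [I], this is the ideal generated by [I] and [u]. *)
Definition mv_ideal_adjoin I u : set A :=
  [set z | exists2 m, I m & exists n, mvle z (m ⊕ mvmuln n u)].

Lemma mv_ideal_adjoinP I u : mv_ideal I -> mv_ideal (mv_ideal_adjoin I u).
Proof.
move=> IP; have [_ Id IDp] := IP; split.
- by exists mvzero, mvzero; [exact: mv_ideal0|exists 0; rewrite mvadd0; exact: mvlexx].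
- move=> a b ab [m Im [n bn]]; exists m => //; exists n; exact: mvle_trans bn.
move=> a b [m Im [n am]] [p Ip [k bp]]; exists (m ⊕ p); first exact: IDp.
exists (n + k)%N; rewrite mvmulnD.
have -> : m ⊕ p ⊕ (mvmuln n u ⊕ mvmuln k u) =
    m ⊕ mvmuln n u ⊕ (p ⊕ mvmuln k u).
  by rewrite !mvaddA; congr (_ ⊕ _); rewrite -!mvaddA; congr (_ ⊕ _); exact: mvaddC.
exact: mvleD.
Qed.

Lemma sub_mv_ideal_adjoin I u : I `<=` mv_ideal_adjoin I u.
Proof. by move=> a Ia; exists a => //; exists 0; rewrite mvadd0; exact: mvlexx. Qed.

Lemma mem_mv_ideal_adjoin I u : mv_ideal I -> mv_ideal_adjoin I u u.
Proof.
move=> /mv_ideal0 I0; exists mvzero => //.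
by exists 1; rewrite mvadd0l; exact: mvlexx.
Qed.

(** If adjoining [u] reaches the unit, then for some [m] in [I] the element [v ⊖ m] lies below a
    multiple of [u]; being also below [v], it is zero, so [v] is below [m]. *)
Lemma mv_ideal_adjoin_disj I u v : mv_ideal I -> mvdisj v u ->
  mv_ideal_adjoin I u (∼ mvzero) -> I v.
Proof.
move=> [_ Id _] vu [m Im [n /(mvle_trans (mvle1 v))/mvsubLR vm]]; apply: Id Im.
exact: (mvdisj_muln (n := n) vu (mvle_sub v m) vm).
Qed.

(** Zorn's lemma gives an ideal maximal among the proper ideals containing [I]. If it omits [a ⊖ b],
    adjoining this element reaches the unit, so the disjoint element [b ⊖ a] belongs to it. *)
Lemma prime_ideal_ex I : mv_ideal I -> ~ I (∼ mvzero) ->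
  exists M, [/\ mv_ideal M, ~ M (∼ mvzero), I `<=` M &
                forall a b, M (a ⊖ b) \/ M (b ⊖ a)].
Proof.
(* Taking the union with [I] takes care of the empty chain: its union is empty and yields the ideal
   [I]. *)
move=> IP I1; pose P X := mv_ideal (I `|` X) /\ ~ (I `|` X) (∼ mvzero).
have [F FP Ftot|M0 [[MP M1] Mmax]] := @Zorn_bigcup A P.
  have [_ Id IDp] := IP; split; last first.
    case=> // -[X FX X1]; have [_] := FP _ FX; apply; right; exact: X1.
  split.
  - by exists mvzero; left; exact: mv_ideal0.
  - move=> a b ab [Ib|[X FX Xb]]; first by left; apply: Id Ib.
    have [[_ Xd _] _] := FP _ FX; have [Ia|Xa] := Xd _ _ ab (or_intror Xb).
      by left.
    by right; exists X.
  have sumX (X : set A) a b : F X -> (I `|` X) a -> (I `|` X) b ->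
      (I `|` \bigcup_(X in F) X) (a ⊕ b).
    move=> FX Xa Xb; have [[_ _ XD] _] := FP _ FX.
    by have [Iab|Xab] := XD _ _ Xa Xb; [left|right; exists X].
  move=> a b [Ia|[X FX Xa]] [Ib|[Y FY Yb]].
  - by left; exact: IDp.
  - exact: sumX FY (or_introl Ia) (or_intror Yb).
  - exact: sumX FX (or_intror Xa) (or_introl Ib).
  - have [XY|YX] := Ftot _ _ FX FY.
      exact: sumX FY (or_intror (XY _ Xa)) (or_intror Yb).
    exact: sumX FX (or_intror Xa) (or_intror (YX _ Yb)).
exists (I `|` M0); split=> // a b.
have [|nab] := pselect ((I `|` M0) (a ⊖ b)); [by left|right].
apply: (mv_ideal_adjoin_disj MP (mvdisjC (@mvdisj_sub _ a b))).
apply: contrapT => N1.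
set N := mv_ideal_adjoin _ _ in N1.
have NI : I `|` N = N.
  by apply/setUidPr => x Ix; apply: sub_mv_ideal_adjoin; left.
apply: (Mmax N); last by rewrite /P NI; split=> //; exact: mv_ideal_adjoinP.
split; first by move=> x Mx; apply: sub_mv_ideal_adjoin; right.
by move=> /(_ _ (mem_mv_ideal_adjoin _ MP)) Mab; apply: nab; right.
Qed.

End Ideals.

(** * Constants of a Riesz MV-algebra *)

Definition clamp01 (R : realType) (r : R) : R := Num.max 0 (Num.min r 1).

Lemma clamp01_ge0 (R : realType) (r : R) : 0 <= clamp01 r.
Proof. by rewrite le_max lexx. Qed.

Lemma clamp01_le1 (R : realType) (r : R) : clamp01 r <= 1.
Proof. by rewrite ge_max ler01 ge_min lexx orbT. Qed.

Lemma clamp01_id (R : realType) (r : R) : 0 <= r <= 1 -> clamp01 r = r.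
Proof.
by move=> /andP[r0 r1]; rewrite /clamp01; case: (leP r 1) => ?; case: leP; lra.
Qed.

Lemma clamp01_le0 (R : realType) (r : R) : r <= 0 -> clamp01 r = 0.
Proof. by move=> r0; rewrite /clamp01; case: (leP r 1) => ?; case: leP; lra. Qed.

Lemma clamp01_ge1 (R : realType) (r : R) : 1 <= r -> clamp01 r = 1.
Proof. by move=> r0; rewrite /clamp01; case: (leP r 1) => ?; case: leP; lra. Qed.

Section Constants.
Variables (R : realType) (V : rieszMVType R).
Implicit Types r q : R.

(** The scalar is clamped so that constants exist for every real, which keeps range conditions out
    of the statements about cuts. *)
Definition mv_const r : V :=
  rscale (Itv01 (clamp01_ge0 r) (clamp01_le1 r)) (∼ mvzero).

Lemma mv_const_clamp r q : clamp01 r = clamp01 q -> mv_const r = mv_const q.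
Proof. by move=> rq; congr rscale; apply: val_inj. Qed.

Lemma mv_const_sub r q :
  mv_const r ⊖ mv_const q = mv_const (clamp01 r - clamp01 q).
Proof.
rewrite -rscaleBl; congr rscale; apply: val_inj => /=.
have := clamp01_le1 r; have := clamp01_ge0 q.
move: (clamp01 r) (clamp01 q) => a b b0 a1.
have [ab|ab] := leP a b; first by rewrite clamp01_le0; [case: leP; lra|lra].
by rewrite clamp01_id; [case: leP; lra|lra].
Qed.

Lemma mv_const0 : mv_const 0 = mvzero.
Proof.
by have := mv_const_sub 0 0; rewrite subrr mvsubxx => <-.
Qed.

Lemma mv_const1 : mv_const 1 = ∼ mvzero.
Proof.
rewrite -[RHS](@rscale1 R V); congr rscale; apply: val_inj.
by rewrite /= clamp01_ge1.
Qed.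

Lemma mv_const_le0 r : r <= 0 -> mv_const r = mvzero.
Proof.
by move=> r0; rewrite -mv_const0; apply: mv_const_clamp; rewrite !clamp01_le0.
Qed.

Lemma mv_const_ge1 r : 1 <= r -> mv_const r = ∼ mvzero.
Proof.
by move=> r0; rewrite -mv_const1; apply: mv_const_clamp; rewrite !clamp01_ge1.
Qed.

Lemma le_clamp01 r q : r <= q -> clamp01 r <= clamp01 q.
Proof.
by move=> rq; apply: le_max2 => //; exact: le_min2.
Qed.

Lemma mv_const_le r q : r <= q -> mvle (mv_const r) (mv_const q).
Proof.
move=> rq; rewrite /mvle mv_const_sub mv_const_le0//.
by rewrite subr_le0 le_clamp01.
Qed.

Lemma mv_constN r : ∼ mv_const r = mv_const (1 - r).
Proof.
rewrite -mvsub1l -mv_const1 mv_const_sub; apply: mv_const_clamp.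
rewrite (clamp01_ge1 (lexx 1)).
have [r0|r0] := leP r 0; first by rewrite (clamp01_le0 r0) !clamp01_ge1//; lra.
have [r1|r1] := leP 1 r; first by rewrite (clamp01_ge1 r1) !clamp01_le0//; lra.
by rewrite (@clamp01_id _ r)//; lra.
Qed.

Lemma mv_constD r q : 0 <= r -> 0 <= q ->
  mv_const r ⊕ mv_const q = mv_const (r + q).
Proof.
move=> r0 q0; have [r1|r1] := leP 1 r.
  by rewrite (mv_const_ge1 r1) mvadd1l mv_const_ge1//; lra.
have [q1|q1] := leP 1 q.
  by rewrite (mv_const_ge1 q1) mvaddC mvadd1l mv_const_ge1//; lra.
rewrite mvaddE mv_constN mv_const_sub mv_constN; apply: mv_const_clamp.
rewrite (@clamp01_id _ (1 - r)) ?(@clamp01_id _ q); [|lra..].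
by congr clamp01; lra.
Qed.

(** Only an inequality holds for arbitrary signs: clamping a negative summand to 0 can raise the
    right-hand side. *)
Lemma mv_constD_ge r q : mvle (mv_const (r + q)) (mv_const r ⊕ mv_const q).
Proof.
have [r0|r0] := leP r 0.
  by apply: mvle_trans (mvle_addl _ _); apply: mv_const_le; lra.
have [q0|q0] := leP q 0.
  by apply: mvle_trans (mvle_addr _ _); apply: mv_const_le; lra.
by rewrite mv_constD ?(ltW r0) ?(ltW q0)//; exact: mvlexx.
Qed.

Lemma mvmuln_le_const n z r : 0 <= r -> mvle z (mv_const r) ->
  mvle (mvmuln n z) (mv_const (n%:R * r)).
Proof.
move=> r0 zr; elim: n => [|n IH]; first by rewrite /mvle mvsub0l.
rewrite mvmulnS -natr1 mulrDl mul1r addrC -mv_constD ?mulr_ge0//.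
exact: mvleD.
Qed.

End Constants.
Arguments mv_const {R V} r.

(** * The standard part modulo a prime ideal *)

Section CharacterOfIdeal.
Variables (R : realType) (V : rieszMVType R) (M : set V).
Hypotheses (MP : mv_ideal M) (M1 : ~ M (∼ mvzero)).
Hypothesis Mprime : forall a b, M (a ⊖ b) \/ M (b ⊖ a).
Implicit Types (x y : V) (r q : R).

Let Mle x y : mvle x y -> M y -> M x.
Proof. by case: MP => _ + _ xy; apply. Qed.

Let MD x y : M x -> M y -> M (x ⊕ y).
Proof. by case: MP => _ _; apply. Qed.

(** Some multiple of [r] is at least 1, and its constant is the unit, which [M] excludes. *)
Lemma mv_const_notin r : 0 < r -> ~ M (mv_const r).
Proof.
move=> r0 Mr; have Mn n : M (mv_const (n%:R * r)).
  elim: n => [|n IH]; first by rewrite mul0r mv_const0; exact: mv_ideal0.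
  rewrite -natr1 mulrDl mul1r -mv_constD ?(ltW r0)//; first exact: MD.
  by rewrite mulr_ge0// ltW.
have := Mn (Num.bound r^-1); rewrite mv_const_ge1//.
rewrite -[X in X <= _](mulVf (lt0r_neq0 r0)) ler_pM2r//.
by rewrite ltW// archi_boundP// invr_ge0 ltW.
Qed.

(* V / M is a chain, M being prime: every x is comparable with every constant. *)
Let E x : set R := [set r | 0 <= r <= 1 /\ M (mv_const r ⊖ x)].
Definition std_part x : R := sup (E x).

Let E_sup x : has_sup (E x).
Proof.
split; last by exists 1 => r [/andP[]].
exists 0; split; first by rewrite lexx ler01.
by rewrite mv_const0 mvsub0l; exact: mv_ideal0.
Qed.

Let std_part_ge0 x : 0 <= std_part x.
Proof.
apply: sup_upper_bound => //; split; first by rewrite lexx ler01.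
by rewrite mv_const0 mvsub0l; exact: mv_ideal0.
Qed.

Lemma std_part_le1 x : std_part x <= 1.
Proof. by apply: ge_sup; [have [] := E_sup x|move=> r [/andP[]]]. Qed.

Lemma std_part_lt x r : r < std_part x -> M (mv_const r ⊖ x).
Proof.
move=> rx; have d0 : 0 < std_part x - r by lra.
have [e [_ Me]] := sup_adherent d0 (E_sup x); rewrite -/(std_part x) => re.
by apply: Mle Me; apply: mvle_sub2r; apply: mv_const_le; lra.
Qed.

(** By primality the only alternative puts [r] in [E x], hence below the supremum. For [r] above 1
    the constant is the unit. *)
Lemma std_part_gt x r : std_part x < r -> M (x ⊖ mv_const r).
Proof.
move=> xr; have [r1|r1] := leP r 1; last first.
  rewrite mv_const_ge1 ?(ltW r1)//; apply: Mle (mv_ideal0 MP).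
  by rewrite /mvle mvsub0; exact: mvle1.
have [//|Mr] := Mprime x (mv_const r).
have : r <= std_part x.
  by apply: sup_upper_bound => //; split=> //; have := std_part_ge0 x; lra.
lra.
Qed.

(** A gap between [c] and the standard part would put a positive constant in [M]. *)
Lemma std_partE x c : (forall r, r < c -> M (mv_const r ⊖ x)) ->
  (forall r, c < r -> M (x ⊖ mv_const r)) -> 0 <= c <= 1 -> std_part x = c.
Proof.
have gap r q : 0 <= r -> r < q -> q <= 1 ->
    M (x ⊖ mv_const r) -> M (mv_const q ⊖ x) -> False.
  move=> r0 rq q1 Mr Mq; apply: (@mv_const_notin (q - r)); first lra.
  have <- : mv_const q ⊖ mv_const r = mv_const (q - r) :> V.
    by rewrite mv_const_sub !clamp01_id//; lra.
  by apply: Mle (mvsub_trans _ x _) _; exact: MD.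
have x1 := std_part_le1 x; have x0 := std_part_ge0 x.
move=> lo hi c01; have [xc|cx|//] := ltgtP (std_part x) c.
  (* The two points trisect the gap, so that both cut conditions apply with strict inequalities. *)
  exfalso; apply: (@gap ((2 * std_part x + c) / 3) ((std_part x + 2 * c) / 3));
    [lra..| | ].
  - by apply: std_part_gt; lra.
  - by apply: lo; lra.
exfalso; apply: (@gap ((2 * c + std_part x) / 3) ((c + 2 * std_part x) / 3));
    [lra..| | ].
- by apply: hi; lra.
- by apply: std_part_lt; lra.
Qed.

Lemma std_part0 x : M x -> std_part x = 0.
Proof.
move=> Mx; apply: std_partE; last by rewrite lexx ler01.
  move=> r /ltW r0; rewrite mv_const_le0// mvsub0l; exact: mv_ideal0.
by move=> r r0; apply: Mle Mx; exact: mvle_sub.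
Qed.

Lemma std_part_char : mv_char std_part.
Proof.
split; [|move=> x y|move=> x|exact: std_part_ge0].
- by apply: std_part0; exact: mv_ideal0.
- have := std_part_ge0 x; have := std_part_ge0 y => y0 x0.
  apply: std_partE => [r|r|]; last by case: (leP (_ + _) 1); lra.
  + rewrite lt_min => /andP[rxy _].
    (* Half of the slack: [r] becomes a sum of two reals, each strictly below one of the standard
       parts. *)
    pose d := (std_part x + std_part y - r) / 2.
    have xd : M (mv_const (std_part x - d) ⊖ x).
      by apply: std_part_lt; rewrite /d; lra.
    have yd : M (mv_const (std_part y - d) ⊖ y).
      by apply: std_part_lt; rewrite /d; lra.
    apply: Mle (MD xd yd); apply: mvle_trans (mvsubDD _ _ _ _).
    apply: mvle_sub2r.
    have -> : r = std_part x - d + (std_part y - d) by rewrite /d; lra.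
    exact: mv_constD_ge.
  rewrite gt_min => /orP[rxy|/ltW r1]; last first.
    rewrite mv_const_ge1//; apply: Mle (mv_ideal0 MP).
    by rewrite /mvle mvsub0; exact: mvle1.
  pose d := (r - std_part x - std_part y) / 2.
  have xd : M (x ⊖ mv_const (std_part x + d)).
    by apply: std_part_gt; rewrite /d; lra.
  have yd : M (y ⊖ mv_const (std_part y + d)).
    by apply: std_part_gt; rewrite /d; lra.
  apply: Mle (MD xd yd); apply: mvle_trans (mvsubDD _ _ _ _).
  have -> : r = std_part x + d + (std_part y + d) by rewrite /d; lra.
  by rewrite -mv_constD; [exact: mvlexx|rewrite /d; lra..].
have x0 := std_part_ge0 x; have x1 := std_part_le1 x.
apply: std_partE; last lra.
  (* Passing to complements exchanges the lower and the upper cut, by [mvsubN]. *)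
  move=> r rx; have -> : r = 1 - (1 - r) by lra.
  by rewrite -mv_constN mvsubN; apply: std_part_gt; lra.
move=> r rx; have -> : r = 1 - (1 - r) by lra.
by rewrite -mv_constN mvsubN; apply: std_part_lt; lra.
Qed.

End CharacterOfIdeal.

Lemma mv_char_ideal (R : realType) (V : rieszMVType R) (I : set V) :
    mv_ideal I -> ~ I (∼ mvzero) ->
  exists2 f : V -> R, mv_char f & forall x, I x -> f x = 0.
Proof.
move=> IP I1; have [M [MP M1 IM Mprime]] := prime_ideal_ex IP I1.
exists (std_part M); first exact: std_part_char.
by move=> x /IM Mx; exact: std_part0.
Qed.

(** * Characters of a Riesz hull *)

(* The supremum s of the multiples of z satisfies s <= s ⊖ z; the multiples stay
   below 1/2, so nothing is truncated and z vanishes. *)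
Lemma mv_complete_archi (R : realType) (V : rieszMVType R) (z : V) :
  mv_complete V -> (forall r : R, 0 < r -> mvle z (mv_const r)) -> z = mvzero.
Proof.
move=> Vc zr; have [[s [sub slub]] _] := Vc (range (fun n => mvmuln n z)).
have h0 : (0 : R) < 1 / 2 by lra.
pose c : V := mv_const (1 / 2 : R).
(* The constant 1/2 is its own negation, so elements below it add up without truncation, as [mvaddK]
   requires. *)
have cN : c = ∼ c by rewrite /c mv_constN; congr mv_const; lra.
have zNc x : mvle x c -> mvle c (∼ x) by move=> xc; rewrite cN; exact: mvleN.
have nzc n : mvle (mvmuln n z) c.
  case: n => [|n]; first by rewrite /mvle mvsub0l.
  have n0 : (0 : R) < n.+1%:R by rewrite ltr0n.
  have r0 : (0 : R) < 1 / 2 / n.+1%:R by rewrite divr_gt0.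
  (* The bound on [z] is taken to be 1/2 divided by the number of summands. *)
  rewrite /c (_ : 1 / 2 = n.+1%:R * (1 / 2 / n.+1%:R)).
    by apply: mvmuln_le_const; [exact: ltW|exact: zr].
  by rewrite [RHS]mulrC divfK ?lt0r_neq0.
have sc : mvle s c by apply: slub => _ [n _ <-].
have zc : mvle z c by exact: zr.
have zs : mvle z s by apply: sub; exists 1.
have sz : mvle s (s ⊖ z).
  apply: slub => _ [n _ <-].
  (* Each multiple is the next one minus [z], and the next one is still below [s]. *)
  rewrite -(@mvaddK _ (mvmuln n z) z); last exact: mvle_trans (nzc n) (zNc _ zc).
  by apply: mvle_sub2r; apply: sub; exists n.+1 => //; rewrite mvmulnS mvaddC.
have {}sz : s = s ⊖ z by apply: mvle_anti sz _; exact: mvle_sub.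
have szs : z ⊕ s = s by rewrite {1}sz mvaddsub.
rewrite -(@mvaddK _ z s) ?szs ?mvsubxx//.
exact: mvle_trans zc (zNc _ sc).
Qed.

Lemma mv_char_const (R : realType) (V : rieszMVType R) (f : V -> R) r :
  mv_char f -> f (mv_const r) = clamp01 r.
Proof.
move=> fP; have [f0 _ fN _] := fP.
by rewrite (mv_char_scale fP) fN f0 subr0 mulr1.
Qed.

(** Choose [r > 0] whose constant is not above [z]. The ideal generated by [mv_const r ⊖ z] is
    proper, otherwise the disjoint element [z ⊖ mv_const r] would be zero. A character vanishing on
    it has at [z] at least the clamped value of [r]. *)
Lemma mv_char_neq0 (R : realType) (V : rieszMVType R) (z : V) :
  mv_complete V -> z <> mvzero -> exists2 f : V -> R, mv_char f & f z <> 0.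
Proof.
move=> Vc z0.
have [r r0 zr] : exists2 r : R, 0 < r & ~ mvle z (mv_const r).
  apply: contra_notP z0 => nr; apply: (mv_complete_archi Vc) => r r0.
  by apply: contrapT => zr; apply: nr; exists r.
have IP := mv_ideal_adjoinP (mv_const r ⊖ z) (mv_ideal_set0 V).
have [|f fP fI] := @mv_char_ideal R V _ IP.
  by move/(mv_ideal_adjoin_disj (mv_ideal_set0 V) (@mvdisj_sub V _ _)); exact: zr.
exists f => // fz; have := fI _ (mem_mv_ideal_adjoin _ (mv_ideal_set0 V)).
rewrite (mv_char_sub fP) fz mv_char_const// subr0 => /max_idPr.
have [r1|/ltW r1] := leP r 1; first by rewrite clamp01_id; lra.
by rewrite clamp01_ge1//; lra.
Qed.

(** Equivalently, [A] embeds in a power of the unit interval. *)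
Definition mv_separated (R : realType) (A : mvAlgType) :=
  forall x y : A, (forall f : A -> R, mv_char f -> f x = f y) -> x = y.

Lemma mv_complete_separated (R : realType) (V : rieszMVType R) :
  mv_complete V -> mv_separated R V.
Proof.
move=> Vc x y fxy; have le0 (u v : V) : (forall f : V -> R, mv_char f -> f u = f v) ->
    mvle u v.
  move=> fuv; apply: contrapT => /(mv_char_neq0 Vc)[f fP]; apply.
  by rewrite (mv_char_sub fP) fuv// subrr maxxx.
by apply: mvle_anti; apply: le0 => // f fP; rewrite fxy.
Qed.

Lemma mv_separated_sub (R : realType) (A B : mvAlgType) (j : A -> B) :
  mv_embedding j -> mv_separated R B -> mv_separated R A.
Proof.
move=> [jP jI] sB x y fxy; apply/jI/sB => f fP.
exact: (fxy (f \o j) (mv_char_comp fP jP)).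
Qed.

Lemma mv_hom_comp (A B C : mvAlgType) (g : B -> C) (f : A -> B) :
  mv_hom g -> mv_hom f -> mv_hom (g \o f).
Proof.
by move=> [g0 gD gN] [f0 fD fN]; split=> [|a b|a] /=; rewrite ?f0 ?fD ?fN.
Qed.

Lemma mv_embedding_comp (A B C : mvAlgType) (g : B -> C) (f : A -> B) :
  mv_embedding g -> mv_embedding f -> mv_embedding (g \o f).
Proof.
by move=> [gP gI] [fP fI]; split; [exact: mv_hom_comp|exact: inj_comp].
Qed.

(** The image of the kernel of [f] generates a proper ideal, since [i] is injective and [f] is 1 at
    the unit. A character vanishing on that ideal restricts to one whose kernel contains that of
    [f], hence to [f] by [mv_char_eq]. *)
Lemma mv_char_extend (R : realType) (A : mvAlgType) (V : rieszMVType R)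
    (i : A -> V) (f : A -> R) : mv_embedding i -> mv_char f ->
  exists2 g : V -> R, mv_char g & g \o i =1 f.
Proof.
move=> [iP iI] fP; have [i0 iD iN] := iP; have [f0 fD fN fge0] := fP.
pose I : set V := [set v | exists2 a, f a = 0 & mvle v (i a)].
have IP : mv_ideal I.
  split.
  - by exists mvzero, mvzero => //; rewrite i0; exact: mvlexx.
  - by move=> u v uv [a fa va]; exists a => //; exact: mvle_trans va.
  move=> u v [a fa ua] [b fb vb]; exists (a ⊕ b).
    by rewrite fD fa fb addr0; apply/min_idPl.
  by rewrite iD; exact: mvleD.
have I1 : ~ I (∼ mvzero).
  move=> [a fa a1]; suff : a = ∼ mvzero.
    by move=> aE; move: fa; rewrite aE fN f0; lra.
  by apply: iI; rewrite iN i0; apply: mvle_anti a1; exact: mvle1.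
have [g gP gI] := @mv_char_ideal R V I IP I1; exists g => //.
move=> a; apply/esym; apply: (mv_char_eq fP (mv_char_comp gP iP)) => b fb.
by apply: gI; exists b => //; exact: mvlexx.
Qed.

(** The image [Q] of [P] in [V] is closed under the Riesz operations and contains [X], so it
    contains the span. *)
Lemma riesz_gen_ind (R : realType) (V : rieszMVType R) (X : set V)
    (P : set (riesz_gen X)) : riesz_closed P ->
  (forall x : riesz_gen X, X (sval x) -> P x) -> forall x, P x.
Proof.
move=> [P0 PD PN PZ] PX x.
pose Q : set V := [set v | exists2 y : riesz_gen X, sval y = v & P y].
have QP : riesz_closed Q.
  split.
  - by exists mvzero.
  - by move=> _ _ [a <- Pa] [b <- Pb]; exists (a ⊕ b) => //; exact: PD.
  - by move=> _ [a <- Pa]; exists (∼ a) => //; exact: PN.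
  - by move=> r _ [a <- Pa]; exists (rscale r a) => //; exact: PZ.
have XQ : X `<=` Q.
  move=> v Xv; have vs := mem_set (sub_riesz_span Xv).
  by exists (exist _ v vs) => //; exact: PX.
have [y /gen_inj <- //] := set_mem (svalP x) Q (conj QP XQ).
Qed.

Section RieszHullTheory.
Variables (R : realType) (A : mvAlgType) (D : riesz_hull_data R A).

Lemma Gamma_map_embedding (G H : ulGroupType) (f : G -> H) (fP : ul_hom f) :
  injective f -> mv_embedding (Gamma_map fP).
Proof.
have [fD fI _ fu] := fP; move=> finj; split; last first.
  by move=> x y /(congr1 sval)/finj/Gamma_inj.
split=> [|x y|x]; apply: Gamma_inj => /=; first exact: ul_hom0 fP.
  by rewrite fI fD fu.
apply: (addIr (f (sval x))).
by rewrite -fD !subrK fu.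
Qed.

Lemma to_compl_embedding : mv_embedding (to_compl D).
Proof.
have [isoP /bij_inj isoI] := rh_isoP D; have [dP dI _ _] := rh_divP D.
have [cP _ _] := rh_complP D.
apply: (mv_embedding_comp cP).
exact: (mv_embedding_comp (Gamma_map_embedding (rh_div_hom D) dI) (conj isoP isoI)).
Qed.

Lemma sval_embedding (X : set (rh_compl D)) :
  mv_embedding (fun x : riesz_gen X => sval x).
Proof. by split=> [|x y]; [split|exact: gen_inj]. Qed.

Lemma riesz_iota_embedding : mv_embedding (riesz_iota D).
Proof.
have [[c0 cD cN] cI] := to_compl_embedding.
split; last by move=> x y /(congr1 sval)/cI.
by split=> [|x y|x]; apply: gen_inj; [exact: c0|exact: cD|exact: cN].
Qed.

Lemma riesz_hull_separated : mv_separated R (riesz_hull D).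
Proof.
apply: mv_separated_sub (sval_embedding _) _.
by apply: mv_complete_separated; have [] := rh_complP D.
Qed.

Lemma riesz_hull_ind (P : set (riesz_hull D)) : riesz_closed P ->
  (forall a, P (riesz_iota D a)) -> forall x, P x.
Proof.
move=> Pc Pi; apply: riesz_gen_ind => // x [a _ ax].
by rewrite (_ : x = riesz_iota D a)//; exact: gen_inj.
Qed.

(** The set where two characters agree is closed under scalars because characters are homogeneous,
    so agreement on the generators suffices. *)
Lemma riesz_hull_char_eq (f g : riesz_hull D -> R) : mv_char f -> mv_char g ->
  f \o riesz_iota D =1 g \o riesz_iota D -> f =1 g.
Proof.
move=> fP gP fg; apply: riesz_hull_ind => //.
have [f0 fD fN _] := fP; have [g0 gD gN _] := gP.
split=> [|a b|a|r a] /=; first by rewrite f0 g0.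
- by rewrite fD gD => -> ->.
- by rewrite fN gN => ->.
- by rewrite (mv_char_scale fP) (mv_char_scale gP) => ->.
Qed.

End RieszHullTheory.

(** * The induced homomorphism between Riesz hulls *)

Theorem lemma5p1 (R : realType) (A B : mvAlgType)
    (ssA : mv_semisimple A) (ssB : mv_semisimple B)
    (RA : riesz_hull_data R A) (RB : riesz_hull_data R B)
    (h : A -> B) (hh : mv_hom h) :
  (exists! Rh : riesz_hull RA -> riesz_hull RB,
     mv_hom Rh /\ Rh \o riesz_iota RA = riesz_iota RB \o h) /\
  (mv_embedding h ->
   forall Rh : riesz_hull RA -> riesz_hull RB,
     mv_hom Rh -> Rh \o riesz_iota RA = riesz_iota RB \o h ->
     mv_embedding Rh).
Proof.
have iA := riesz_iota_embedding RA; have iB := riesz_iota_embedding RB.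
have sA := @riesz_hull_separated R A RA; have sB := @riesz_hull_separated R B RB.
split; last first.
  move=> hE Rh RhP Rhi; split=> // x y xy; apply: sA => f fP.
  (* Every character [f] of the first hull factors through [Rh]: its restriction to [A] extends
     along [riesz_iota RB \o h] to some [g], and [f] and [g \o Rh] agree on the generators. *)
  have [g gP gf] := mv_char_extend (mv_embedding_comp iB hE)
    (mv_char_comp fP (proj1 iA)).
  suff E : f =1 g \o Rh by rewrite !E /= xy.
  apply: riesz_hull_char_eq => //; first exact: mv_char_comp.
  by move=> a; rewrite -gf /= -[Rh _]/((Rh \o riesz_iota RA) a) Rhi.
have ihP : mv_hom (riesz_iota RB \o h) by exact: mv_hom_comp (proj1 iB) hh.
(* Pairs of characters inducing the same character of [A]. *)
pose compat (f : riesz_hull RA -> R) (g : riesz_hull RB -> R) :=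
  [/\ mv_char f, mv_char g & f \o riesz_iota RA =1 g \o (riesz_iota RB \o h)].
have compat_ex g : mv_char g -> exists f, compat f g.
  move=> gP; have [f fP fg] := mv_char_extend iA (mv_char_comp gP ihP).
  by exists f; split.
have Rh_ex x : exists y, forall f g, compat f g -> f x = g y.
  move: x; apply: riesz_hull_ind => [|a]; last first.
    by exists (riesz_iota RB (h a)) => f g [_ _]; exact.
  split.
  - by exists mvzero => f g [[-> _ _ _] [-> _ _ _] _].
  - move=> a b [a' aE] [b' bE]; exists (a' ⊕ b') => f g fg.
    have [[_ fD _ _] [_ gD _ _] _] := fg.
    by rewrite fD gD (aE _ _ fg) (bE _ _ fg).
  - move=> a [a' aE]; exists (∼ a') => f g fg.
    have [[_ _ fN _] [_ _ gN _] _] := fg.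
    by rewrite fN gN (aE _ _ fg).
  move=> r a [a' aE]; exists (rscale r a') => f g fg.
  have [fP gP _] := fg.
  by rewrite (mv_char_scale fP) (mv_char_scale gP) (aE _ _ fg).
(* Each chosen value is the only possible one: every [g] occurs in a compatible pair, and characters
   separate the points of the second hull. *)
have [Rh RhE] := choice Rh_ex.
exists Rh; split; last first.
  move=> Rh' [RhP' Rhi']; apply/funext => x; apply: sB => g gP.
  have [f fg] := compat_ex g gP; have [fP _ fi] := fg.
  rewrite -(RhE x _ _ fg).
  (* Both [f] and [g \o Rh'] are characters of the first hull, so they need only be compared on the
     image of [A]. *)
  apply: (riesz_hull_char_eq fP (mv_char_comp gP RhP')) => a.
  by rewrite fi /= -[Rh' _]/((Rh' \o riesz_iota RA) a) Rhi'.
split; last first.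
  apply/funext => a; apply: sB => g /compat_ex[f fg].
  by rewrite -(RhE _ _ _ fg); have [_ _ fi] := fg; exact: fi.
(* Each law is tested on a character [g]; a compatible [f] turns it into the corresponding law for
   [f]. *)
split=> [|x y|x]; apply: sB => g /compat_ex[f fg];
  rewrite -(RhE _ _ _ fg); have [[f0 fD fN _] [g0 gD gN _] _] := fg.
- by rewrite f0 g0.
- by rewrite fD gD -!(RhE _ _ _ fg).
- by rewrite fN gN -(RhE _ _ _ fg).
Qed.
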